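(* Let $\phi:\Sigma^*\to\Gamma^*$ be an injective morphism and let $\mathcal{L}\subseteq\Sigma^*$. If $\phi$ is interference-free on $\mathcal{L}$, then $\phi$ is recognizable on $\mathcal{L}$.
   Context: A morphism $\phi:\Sigma^*\to\Gamma^*$ satisfies $\phi(uv)=\phi(u)\phi(v)$. Its set of images is $\mathrm{Im}(\phi)=\{\phi(c):c\in\Sigma\}$. $\phi$ is injective if $\phi(u)\neq\phi(v)$ for all $u\neq v\in\Sigma^*$. A word $w\in\Gamma^*$ admits an image factorization if $w=X_1\cdots X_n$ with each $X_i\in\mathrm{Im}(\phi)$ ($n\ge 0$). A word $w$ admits an interfered image factorization if $w=x\cdot y\cdot z$ where $x$ is a proper (possibly empty) suffix of some image, $y$ admits an image factorization, $z$ is a proper (possibly empty) prefix of some image, and $xz\neq\varepsilon$. A word $w$ is an inner image factor if $w$ is a proper factor of some image $\phi(c)$ but is neither a prefix nor a suffix of $\phi(c)$. For injective $\phi$ and $\mathcal{L}\subseteq\Sigma^*$, $\phi$ is interference-free on $\mathcal{L}$ if for every non-empty $u\in\mathcal{L}$, $\phi(u)$ does not admit an interfered image factorization and $\phi(u)$ is not an inner image factor. A rotation of $w$ is a word $w[i..|w|]\,w[1..i-1]$ for some $1\le i\le|w|$. A word $w$ admits a circular image factorization if $w=q\cdot r\cdot p$ where $r$ admits an image factorization, $pq=\phi(c)$ for some $c\in\Sigma$, and $p\neq\varepsilon$. An injective $\phi$ is recognizable on $\mathcal{L}$ if for every non-empty $u\in\mathcal{L}$ and every rotation $w'$ of $\phi(u)$,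 $w'$ admits a unique circular image factorization. *)

(* Defs.v *)
(* Words over an alphabet T are sequences [seq T]; alphabets are arbitrary
   eqTypes, not assumed finite, and languages are Prop-valued predicates. *)
From mathcomp Require Import all_boot.

Set Implicit Arguments.
Unset Strict Implicit.
Unset Printing Implicit Defensive.

Section Words.

Variable T : eqType.
Implicit Types x w : seq T.

Definition proper_prefix x w : Prop := prefix x w /\ x <> w.
Definition proper_suffix x w : Prop := suffix x w /\ x <> w.
Definition proper_factor x w : Prop := infix x w /\ x <> w.

(* 0-based: [rot i w = drop i w ++ take i w] is w[i+1..|w|] w[1..i]. *)
Definition rotation w' w : Prop := exists2 i, i < size w & w' = rot i w.

End Words.

Section Morphisms.

Variables (Sigma Gamma : eqType).

Definition word_morphism (phi : seq Sigma -> seq Gamma) : Prop :=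
  forall u v, phi (u ++ v) = phi u ++ phi v.

Variable phi : seq Sigma -> seq Gamma.
Implicit Types (w X : seq Gamma) (Xs : seq (seq Gamma)).

Definition is_image X : Prop := exists c : Sigma, X = phi [:: c].

Definition image_factorization w Xs : Prop :=
  w = flatten Xs /\ (forall X, X \in Xs -> is_image X).

Definition admits_image_factorization w : Prop :=
  exists Xs, image_factorization w Xs.

Definition admits_interfered_image_factorization w : Prop :=
  exists x y z : seq Gamma,
    [/\ w = x ++ y ++ z,
        exists2 X, is_image X & proper_suffix x X,
        admits_image_factorization y,
        exists2 Z, is_image Z & proper_prefix z Z
      & x ++ z <> [::]].

Definition inner_image_factor w : Prop :=
  exists c : Sigma,
    [/\ proper_factor w (phi [:: c]),
        ~ prefix w (phi [:: c])
      & ~ suffix w (phi [:: c])].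

Definition interference_free (L : seq Sigma -> Prop) : Prop :=
  forall u, L u -> u <> [::] ->
    ~ admits_interfered_image_factorization (phi u) /\
    ~ inner_image_factor (phi u).

(* The factorization w = q . r . p is recorded as the triple (q, Xs, p), where
   Xs = [:: X_1; ...; X_n] is the image factorization of r, so that uniqueness
   covers the way in which r is factored as well. *)
Definition circular_image_factorization w
    (f : seq Gamma * seq (seq Gamma) * seq Gamma) : Prop :=
  let: (q, Xs, p) := f in
  exists r : seq Gamma,
    [/\ w = q ++ r ++ p,
        image_factorization r Xs,
        is_image (p ++ q)
      & p <> [::]].

Definition recognizable (L : seq Sigma -> Prop) : Prop :=
  forall u, L u -> u <> [::] ->
    forall w', rotation w' (phi u) ->
      exists! f, circular_image_factorization w' f.

End Morphisms.

(* Main.v *)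
(** A circular factorization of a rotation of [phi u] cuts the circular word
    [phi u] into images.  If the starting point of [phi u] lies strictly inside
    one of these images, split there as [z ++ x], then reading the circle from
    that point gives [phi u = x ++ ... ++ z], an interfered image factorization.
    Hence the starting point is a cut, the factorization reads as a
    factorization of [phi u] into images, and injectivity identifies it with
    the one given by [u]. *)
Require Import Defs.
From mathcomp Require Import all_boot.

Set Implicit Arguments.
Unset Strict Implicit.
Unset Printing Implicit Defensive.

Lemma cat_eq_cat (T : Type) (s1 s2 t1 t2 : seq T) :
  s1 ++ s2 = t1 ++ t2 -> size s1 <= size t1 ->
  exists2 d, t1 = s1 ++ d & s2 = d ++ t2.
Proof.
move=> E le; exists (drop (size s1) t1).
  have := congr1 (take (size s1)) E.
  by rewrite take_size_cat // takel_cat // => {1}->; rewrite cat_take_drop.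
have := congr1 (drop (size s1)) E.
rewrite drop_size_cat // drop_cat => ->.
case: ltngtP le => // ->.
by rewrite subnn drop0 drop_size.
Qed.

Section FlattenCut.

Variable T : eqType.
Implicit Types (A B p q : seq T) (Xs Ys Zs : seq (seq T)).

(** The block that gets cut is the one carrying the last letter of [A]. A cut on a block boundary
    thus belongs to the block on its left, with [q] empty. *)
Lemma flatten_cut_after Xs A B : flatten Xs = A ++ B -> A <> [::] ->
  exists Zs p q Ys, [/\ Xs = Zs ++ (p ++ q) :: Ys, A = flatten Zs ++ p,
                        B = q ++ flatten Ys & p <> [::]].
Proof.
elim: Xs A => [|X Xs IH] A /=; first by case: A.
move=> E A0; have [le|lt] := leqP (size A) (size X).
  have [d -> ->] := cat_eq_cat (esym E) le.
  by exists [::], A, d, Xs.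
have [d EA Ed] := cat_eq_cat E (ltnW lt).
have d0 : d <> [::] by move=> d0; move: lt; rewrite EA d0 cats0 ltnn.
have [Zs [p [q [Ys [-> Ep -> p0]]]]] := IH _ Ed d0.
by exists (X :: Zs), p, q, Ys; split; rewrite // EA Ep /= -catA.
Qed.

(** Opposite convention: the block is the one carrying the first letter of [A], so an empty [a]
    signals that [A] starts on a block boundary. *)
Lemma flatten_cut_before Xs A B : flatten Xs = B ++ A -> A <> [::] ->
  exists Zs a b Ys, [/\ Xs = Zs ++ (a ++ b) :: Ys, B = flatten Zs ++ a,
                        A = b ++ flatten Ys & b <> [::]].
Proof.
elim: Xs B => [|X Xs IH] B /=; first by case: B => //; case: A.
move=> E A0; have [le|lt] := leqP (size X) (size B).
  have [d EB Ed] := cat_eq_cat E le.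
  have [Zs [a [b [Ys [-> Ea -> b0]]]]] := IH _ Ed A0.
  by exists (X :: Zs), a, b, Ys; split; rewrite // EB Ea /= -catA.
have [d EX ->] := cat_eq_cat (esym E) (ltnW lt).
exists [::], B, d, Xs; split=> //; first by rewrite EX.
by move=> d0; move: lt; rewrite EX d0 cats0 ltnn.
Qed.

(** If [Zs'] were longer, [flatten Zs'] would begin with [flatten Zs ++ p ++ q], and comparing
    lengths would leave no room for a non-empty [p']. *)
Lemma flatten_cut_size Zs Zs' X X' Ys Ys' p p' q :
  Zs ++ X :: Ys = Zs' ++ X' :: Ys' -> X = p ++ q ->
  flatten Zs ++ p = flatten Zs' ++ p' -> p' <> [::] -> size Zs' <= size Zs.
Proof.
move=> EM EX EA p0; rewrite leqNgt; apply/negP => lt.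
have [[|D d] ED] := cat_eq_cat EM (ltnW lt).
  by move: lt; rewrite ED cats0 ltnn.
case=> ? _; subst D; move: EA; rewrite ED flatten_cat /= EX -!catA.
move/(congr1 size); rewrite !size_cat => /eqP.
rewrite eqn_add2l -[X in X == _]addn0 eqn_add2l eq_sym !addn_eq0 !size_eq0.
by case/and3P => _ _ /eqP.
Qed.

(** The size bound, used in both directions, puts the two cuts in the same block. Non-emptiness of
    [p] and [p'] prevents a boundary from being read both as the end of one block and as the start
    of the next. *)
Lemma flatten_cut_unique Zs Zs' Ys Ys' p p' q q' :
  Zs ++ (p ++ q) :: Ys = Zs' ++ (p' ++ q') :: Ys' ->
  flatten Zs ++ p = flatten Zs' ++ p' -> p <> [::] -> p' <> [::] ->
  [/\ Zs = Zs', Ys = Ys', p = p' & q = q'].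
Proof.
move=> EM EA p0 p0'.
have szZ : size Zs = size Zs'.
  apply/eqP; rewrite eqn_leq (flatten_cut_size EM (erefl _) EA p0').
  by rewrite (flatten_cut_size (esym EM) (erefl _) (esym EA) p0).
move/eqP: EM; rewrite eqseq_cat // => /andP[/eqP EZ /eqP[EX ->]].
move/eqP: EA; rewrite EZ eqseq_cat // eqxx /= => /eqP Ep.
by move/eqP: EX; rewrite Ep eqseq_cat // eqxx /= => /eqP ->.
Qed.

(* The cut is chosen with [A] non-empty, so that rotating by [0] is [B = [::]]:
   the last image of a circular factorization always has a non-empty part [p]
   at the end of the rotated word. *)
Lemma rotation_cat w w' : rotation w' w ->
  exists A B, [/\ w = A ++ B, w' = B ++ A & A <> [::]].
Proof.
case=> [[|i]] lt ->.
  by exists w, [::]; rewrite rot0 cats0; split=> // w0; rewrite w0 in lt.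
exists (take i.+1 w), (drop i.+1 w); rewrite cat_take_drop; split=> //.
by case: w lt.
Qed.

End FlattenCut.

Section Recognizability.

Variables (Sigma Gamma : eqType) (phi : seq Sigma -> seq Gamma).
Hypothesis phiM : word_morphism phi.
Implicit Types (u v : seq Sigma) (Xs : seq (seq Gamma)).

Definition letter_images u := [seq phi [:: c] | c <- u].

Lemma morphism_nil : phi [::] = [::].
Proof.
have /eqP := congr1 size (phiM [::] [::]).
by rewrite size_cat -[X in X == _]addn0 eqn_add2l eq_sym size_eq0 => /eqP.
Qed.

Lemma flatten_letter_images u : flatten (letter_images u) = phi u.
Proof.
elim: u => [|c u IH] /=; first by rewrite morphism_nil.
by rewrite IH -phiM.
Qed.

Lemma letter_images_is_image u X : X \in letter_images u -> is_image phi X.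
Proof. by case/mapP=> c _ ->; exists c. Qed.

Lemma images_letter_images Xs :
  (forall X, X \in Xs -> is_image phi X) -> exists u, Xs = letter_images u.
Proof.
elim: Xs => [|X Xs IH] H; first by exists [::].
have [c ->] := H X (mem_head _ _).
have [|u ->] := IH; last by exists (c :: u).
by move=> Y YX; apply: H; rewrite inE YX orbT.
Qed.

(** Each of [x] and [z], being non-empty, makes the other one proper in the image [z ++ x]. *)
Lemma interfered_cat (w x z : seq Gamma) Xs :
  w = x ++ flatten Xs ++ z -> is_image phi (z ++ x) ->
  (forall X, X \in Xs -> is_image phi X) -> x <> [::] -> z <> [::] ->
  admits_interfered_image_factorization phi w.
Proof.
move=> -> imX imXs x0 z0; exists x, (flatten Xs), z; split=> //.
- exists (z ++ x) => //; split; first exact: suffix_suffix.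
  by move/(congr1 size)/eqP; rewrite size_cat -[X in X == _]add0n eqn_add2r
    eq_sym size_eq0 => /eqP.
- by exists Xs.
- exists (z ++ x) => //; split; first exact: prefix_prefix.
  by move/(congr1 size)/eqP; rewrite size_cat -[X in X == _]addn0 eqn_add2l
    eq_sym size_eq0 => /eqP.
- by case: x x0 {imX}.
Qed.

Hypothesis phi_inj : injective phi.

(** Every circular factorization becomes a cut of the same list [letter_images u] after the same
    prefix [A], so that uniqueness of cuts applies. *)
Lemma circular_factorization_cut u (A B q p : seq Gamma) Xs :
  ~ admits_interfered_image_factorization phi (phi u) ->
  phi u = A ++ B -> A <> [::] ->
  circular_image_factorization phi (B ++ A) (q, Xs, p) ->
  exists Zs Ys, [/\ Xs = Ys ++ Zs, A = flatten Zs ++ p &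
                    letter_images u = Zs ++ (p ++ q) :: Ys].
Proof.
move=> nint Eu A0 [r [Ew [Er imXs] imX p0]]; subst r.
(* Injectivity enters here: a factorization of [phi u] into images spells some [v] with
   [phi v = phi u], hence [v = u]. *)
have letters Ms : phi u = flatten Ms ->
    (forall X, X \in Ms -> is_image phi X) -> letter_images u = Ms.
  move=> E /images_letter_images[v Ev]; rewrite Ev; congr letter_images.
  by apply: phi_inj; rewrite E Ev flatten_letter_images.
have E : flatten (q :: rcons Xs p) = B ++ A by rewrite /= flatten_rcons Ew.
(* [phi u] starts at the seam between [B] and [A], and the block after the seam is [q], [p] or a
   member of [Xs]. If it is [q], the seam splits the image [p ++ q] after [p ++ a], which is
   non-empty because [p] is. *)
have [[|Z Zs] [a [b [Ys [EM EB EA b0]]]]] := flatten_cut_before E A0.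
  case: EM => Eq EYs; case: nint.
  apply: (@interfered_cat _ b (p ++ a) Xs) => //.
  - by rewrite Eu EA EB -EYs flatten_rcons -!catA.
  - by rewrite -catA -Eq.
  - by case: (p) p0.
case: EM => Eq; subst Z.
case: (lastP Ys) EA => [|{}Ys Y] EA.
  (* The block is [p]: the seam falls just before the image [p ++ q] when [a] is empty, and
     otherwise splits it into [a] and [b ++ q]. *)
  rewrite cats1 => /rcons_inj[EZ Ep]; subst Zs.
  have [a0|/eqP a0] := eqVneq a [::].
    rewrite a0 cat0s in Ep; exists [::], Xs; split.
    - by rewrite cats0.
    - by rewrite EA Ep /= cats0.
    apply: letters; first by rewrite Eu EA EB Ep a0 /= !cats0 -!catA.
    by move=> X; rewrite inE => /predU1P[->|/imXs].
  case: nint; apply: (@interfered_cat _ (b ++ q) a Xs) => //.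
  - by rewrite Eu EA EB /= cats0 -!catA.
  - by rewrite catA -Ep.
  - by case: (b) b0.
(* The block is the member [a ++ b] of [Xs]. With [a] empty, reading the circle from [b] runs
   through [Ys], then [p ++ q], then [Zs]. *)
rewrite -rcons_cons -rcons_cat => /rcons_inj[EXs Ep]; subst Y.
have imZs X : X \in Zs -> is_image phi X.
  by move=> XZ; apply: imXs; rewrite EXs mem_cat XZ.
have imYs X : X \in Ys -> is_image phi X.
  by move=> XZ; apply: imXs; rewrite EXs mem_cat inE XZ !orbT.
have imab : is_image phi (a ++ b).
  by apply: imXs; rewrite EXs mem_cat mem_head orbT.
have [a0|/eqP a0] := eqVneq a [::].
  rewrite a0 cats0 in EB; rewrite a0 cat0s in EXs imab.
  rewrite flatten_rcons in EA.
  exists (b :: Ys), Zs; split=> //; first by rewrite EA catA.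
  apply: (letters (b :: Ys ++ (p ++ q) :: Zs)).
    by rewrite Eu EA EB /= flatten_cat /= -!catA.
  by move=> X; rewrite inE mem_cat inE => /or4P[/eqP->|/imYs|/eqP->|/imZs].
case: nint; apply: (@interfered_cat _ b a (Ys ++ (p ++ q) :: Zs)) => //.
  by rewrite Eu EA EB flatten_rcons flatten_cat /= -!catA.
by move=> X; rewrite mem_cat inE => /or3P[/imYs|/eqP->|/imZs].
Qed.

End Recognizability.

Theorem theorem20 (Sigma Gamma : eqType) (phi : seq Sigma -> seq Gamma)
    (L : seq Sigma -> Prop) :
  word_morphism phi -> injective phi ->
  interference_free phi L -> recognizable phi L.
Proof.
move=> phiM phi_inj free u Lu u0 w' /rotation_cat[A [B [Eu -> A0]]].
have [nint _] := free u Lu u0.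
have E : flatten (letter_images phi u) = A ++ B.
  by rewrite flatten_letter_images.
have [Zs [p [q [Ys [EM EA EB p0]]]]] := flatten_cut_after E A0.
have im X : X \in Zs ++ (p ++ q) :: Ys -> is_image phi X.
  by rewrite -EM; apply: letter_images_is_image.
(* Reading [B ++ A] meets [q] and [Ys] in [B], then [Zs] and [p] in [A]. *)
exists (q, Ys ++ Zs, p); split.
  exists (flatten (Ys ++ Zs)); split=> //.
  - by rewrite EA EB flatten_cat -!catA.
  - split=> // X; rewrite mem_cat orbC => XZ; apply: im.
    by rewrite mem_cat inE; case/orP: XZ => ->; rewrite ?orbT.
  - by apply: im; rewrite mem_cat mem_head orbT.
case=> [[q' Xs'] p'] F.
have [Zs' [Ys' [-> EA' EM']]] :=
  circular_factorization_cut phiM phi_inj nint Eu A0 F.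
have p0' : p' <> [::] by case: F => r [].
(* Both triples now come from cuts of [letter_images phi u] after [A]. *)
rewrite EM in EM'; rewrite EA in EA'.
by have [-> -> -> ->] := flatten_cut_unique EM' EA' p0 p0'.
Qed.
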